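(* Let $X$ be an affine variety over $\mathbb{C}$ with a flexible point. Then $\mathrm{FD}(X)=\mathbb{C}(X)$.
   Context: Let $X$ be an affine variety over $\mathbb{C}$ with coordinate ring $\mathbb{C}[X]$ and field of rational functions $\mathbb{C}(X)$. A derivation $\delta$ of $\mathbb{C}[X]$ is locally nilpotent if for every $f\in\mathbb{C}[X]$ there is an integer $k\ge 0$ with $\delta^k(f)=0$. Locally nilpotent derivations correspond to algebraic $\mathbb{C}_+$-actions on $X$, where $\mathbb{C}_+$ is the additive group of $\mathbb{C}$. A point $x\in X$ is flexible if the span of the vectors at $x$ tangent to the orbits of algebraic $\mathbb{C}_+$-actions on $X$ coincides with $T_xX$. The field Derksen invariant $\mathrm{FD}(X)$ is the subfield of $\mathbb{C}(X)$ generated by the kernels $\ker\delta\subset\mathbb{C}(X)$, where $\delta$ runs over all non-trivial (i.e. non-zero) locally nilpotent derivations of $\mathbb{C}[X]$, each extended to a derivation of $\mathbb{C}(X)$.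
   Formalization: The formal theorem additionally assumes that X is not isomorphic to the affine line A^1; there every point is flexible but every non-zero locally nilpotent derivation is c·d/dx, so FD(A^1) = C ≠ C(x) and the claim as stated fails. *)

(* Defs.v *)
From HB Require Import structures.
From mathcomp Require Import all_boot all_order all_algebra.
From mathcomp Require Import boolp classical_sets reals.
From mathcomp Require Import complex mpoly.

Set Implicit Arguments.
Unset Strict Implicit.
Unset Printing Implicit Defensive.

Import GRing.Theory.
Local Open Scope ring_scope.
Local Open Scope classical_set_scope.
Local Open Scope quotient_scope.

Section AffineVarieties.
Variable R : realType.
Local Notation C := R[i].

Definition zero_locus n (S : set {mpoly C[n]}) : set 'rV[C]_n :=
  [set x | forall p, S p -> p.@[x 0] = 0].

Definition zariski_closed n (Y : set 'rV[C]_n) : Prop :=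
  exists S : set {mpoly C[n]}, Y = zero_locus S.

(* Varieties are irreducible, as the function field C(X) requires. *)
Record affine_variety := AffineVariety {
  ambient_dim : nat;
  points : set 'rV[C]_ambient_dim;
  points_closed : zariski_closed points;
  points_nonempty : points !=set0;
  points_irreducible : forall Y Z : set 'rV[C]_ambient_dim,
    zariski_closed Y -> zariski_closed Z -> points `<=` Y `|` Z ->
    points `<=` Y \/ points `<=` Z }.

Arguments points : clear implicits.

Local Notation "''P' [ X ]" := {mpoly C[ambient_dim X]} (at level 8).

Definition vanishing_ideal (X : affine_variety) : pred 'P[X] :=
  fun p => `[< forall x, points X x -> p.@[x 0] = 0 >].

Arguments vanishing_ideal : clear implicits.

Section CoordinateRing.
Variable X : affine_variety.

Lemma vanishing_idealP (p : 'P[X]) :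
  reflect (forall x, points X x -> p.@[x 0] = 0) (p \in vanishing_ideal X).
Proof. exact: asboolP. Qed.

Lemma vanishing_ideal_closed : idealr_closed (vanishing_ideal X).
Proof.
split=> [||a u v].
- by apply/vanishing_idealP => x _; rewrite meval0.
- have [x Xx] := points_nonempty X.
  apply/negP => /vanishing_idealP/(_ x Xx)/eqP.
  by rewrite meval1 oner_eq0.
- move=> /vanishing_idealP u0 /vanishing_idealP v0.
  by apply/vanishing_idealP => x Xx; rewrite mevalD mevalM u0 // v0 // mulr0 addr0.
Qed.

Lemma vanishing_ideal_prime : prime_idealr_closed (vanishing_ideal X).
Proof.
move=> u v /vanishing_idealP uv0.
have cl (p : 'P[X]) : zariski_closed [set x | p.@[x 0] = 0].
  exists [set p]; apply/seteqP; split=> x /=; first by move=> px _ ->.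
  by move=> /(_ p erefl).
have sub : points X `<=` [set x | u.@[x 0] = 0] `|` [set x | v.@[x 0] = 0].
  move=> x /uv0; rewrite mevalM => /eqP.
  by rewrite mulf_eq0 => /orP[] /eqP; [left | right].
have [u0|v0] := points_irreducible (cl u) (cl v) sub; apply/orP.
- by left; apply/vanishing_idealP.
- by right; apply/vanishing_idealP.
Qed.

HB.instance Definition _ :=
  isIdealr.Build _ (vanishing_ideal X) vanishing_ideal_closed.
HB.instance Definition _ :=
  isPrimeIdealrClosed.Build _ (vanishing_ideal X) vanishing_ideal_prime.

Definition coordinate_ring :=
  {ideal_quot (vanishing_ideal X : prime_idealr 'P[X])}.

HB.instance Definition _ := GRing.ComNzRing.on coordinate_ring.

Definition coordinate_unit : {pred coordinate_ring} :=
  fun f => `[< exists g : coordinate_ring, g * f = 1 >].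

Definition coordinate_inv (f : coordinate_ring) : coordinate_ring :=
  xget f [set g | g * f = 1].

Lemma coordinate_mulVf :
  {in coordinate_unit, left_inverse 1 coordinate_inv *%R}.
Proof. by move=> f /asboolP /(xgetPex f). Qed.

Lemma coordinate_unitPl (f g : coordinate_ring) :
  g * f = 1 -> coordinate_unit f.
Proof. by move=> gf; apply/asboolP; exists g. Qed.

Lemma coordinate_inv_out : {in [predC coordinate_unit], coordinate_inv =1 id}.
Proof. by move=> f /asboolP nf; apply: xgetPN => g gf; apply: nf; exists g. Qed.

HB.instance Definition _ := GRing.ComNzRing_hasMulInverse.Build coordinate_ring
  coordinate_mulVf coordinate_unitPl coordinate_inv_out.

Lemma coordinate_ring_domain : GRing.integral_domain_axiom coordinate_ring.
Proof. exact: Quotient.rquot_IdomainAxiom. Qed.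

HB.instance Definition _ :=
  GRing.ComUnitRing_isIntegral.Build coordinate_ring coordinate_ring_domain.

Definition function_field := {fraction coordinate_ring}.

HB.instance Definition _ := GRing.Field.on function_field.

Definition ratf (f : coordinate_ring) : function_field := FracField.tofrac f.

Definition coordinate_const (c : C) : coordinate_ring :=
  \pi_coordinate_ring c%:MP.

Definition ratf_const (c : C) : function_field := ratf (coordinate_const c).

End CoordinateRing.

(* Derivations over C of a ring A with structure map iota : C -> A; given the
   Leibniz rule, vanishing on constants is equivalent to C-linearity. *)
Definition derivation (A : comNzRingType) (iota : C -> A) (d : A -> A) : Prop :=
  [/\ forall f g, d (f + g) = d f + d g,
      forall f g, d (f * g) = d f * g + f * d g
    & forall c, d (iota c) = 0].

Section FieldDerksen.
Variable X : affine_variety.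

Definition locally_nilpotent_derivation
    (d : coordinate_ring X -> coordinate_ring X) : Prop :=
  derivation (@coordinate_const X) d /\
  forall f, exists k : nat, iter k d f = 0.

(* The extension D of d to C(X) exists and is unique (quotient rule). *)
Definition field_kernel (d : coordinate_ring X -> coordinate_ring X) :
    set (function_field X) :=
  [set h | exists D : function_field X -> function_field X,
    [/\ derivation (@ratf_const X) D,
        forall f, D (ratf f) = ratf (d f)
      & D h = 0]].

(* Subfields of C(X) are taken over the ground field C. Every field_kernel
   contains the constants, so this only matters for FD(X) if C[X] has no
   non-zero locally nilpotent derivation. *)
Definition subfield_over_C (K : set (function_field X)) : Prop :=
  [/\ forall c, K (ratf_const X c),
      forall f g, K f -> K g -> K (f - g),
      forall f g, K f -> K g -> K (f * g)
    & forall f, K f -> K f^-1].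

Definition field_Derksen : set (function_field X) :=
  smallest subfield_over_C
    [set h | exists d, [/\ locally_nilpotent_derivation d,
                          exists f, d f != 0 & field_kernel d h]].

End FieldDerksen.

Section FlexiblePoints.
Variable X : affine_variety.
Local Notation n := (ambient_dim X).

Definition tangent_space (x : 'rV[C]_n) : set 'rV[C]_n :=
  [set v | forall p, p \in vanishing_ideal X ->
    \sum_(i < n) (p^`M(i)).@[x 0] * v 0 i = 0].

(* A morphism from the product of the affine line and X to affine n-space is
   given by n polynomials in the time variable with coefficients in
   C[x_1, ..., x_n]; orbit_poly s x i is the i-th coordinate of the orbit map
   of x, as a polynomial in the time variable. *)
Definition orbit_poly (s : 'I_n -> {poly 'P[X]}) (x : 'rV[C]_n) (i : 'I_n) :
    {poly C} :=
  map_poly (fun p : 'P[X] => p.@[x 0]) (s i).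

Definition act (s : 'I_n -> {poly 'P[X]}) (t : C) (x : 'rV[C]_n) : 'rV[C]_n :=
  \row_i (orbit_poly s x i).[t].

Definition additive_action (s : 'I_n -> {poly 'P[X]}) : Prop :=
  [/\ forall t x, points X x -> points X (act s t x),
      forall x, points X x -> act s 0 x = x
    & forall t u x, points X x -> act s (t + u) x = act s t (act s u x)].

Definition orbit_tangent (s : 'I_n -> {poly 'P[X]}) (x : 'rV[C]_n) : 'rV[C]_n :=
  \row_i ((orbit_poly s x i)^`()).[0].

Definition linear_subspace (V : set 'rV[C]_n) : Prop :=
  V 0 /\ forall (a : C) u v, V u -> V v -> V (a *: u + v).

Definition flexible_point (x : 'rV[C]_n) : Prop :=
  points X x /\
  smallest linear_subspace
    [set v | exists2 s, additive_action s & v = orbit_tangent s x]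
  = tangent_space x.

Definition isomorphic_to_line : Prop :=
  exists (g : 'P[X]) (h : 'I_n -> {poly C}),
    [/\ forall t, points X (\row_i (h i).[t]),
        forall t : C, g.@[fun i => (h i).[t]] = t
      & forall x, points X x -> \row_i (h i).[g.@[x 0]] = x].

End FlexiblePoints.

End AffineVarieties.

Arguments points {R} _.
Arguments function_field {R} X.
Arguments coordinate_ring {R} X.
Arguments field_Derksen {R} X.
Arguments flexible_point {R} X.
Arguments isomorphic_to_line {R} X.

(* Main.v *)
Require Import Defs.
From HB Require Import structures.
From mathcomp Require Import all_boot all_order all_algebra.
From mathcomp Require Import boolp classical_sets reals.
From mathcomp Require Import complex mpoly ring.

(** Let x be a flexible point of X, with coordinate ring A and function field F.
    An additive action s on X gives a locally nilpotent derivation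
    [generator s] of A, and the tangent vector at x of the orbit of x has
    coordinates [value x (generator s (coord i))].

    Suppose first that two actions have linearly independent tangent vectors
    at x. Some 2 x 2 minor of their generators d1, d2 is then non-zero in A, so
    d1 and d2 are not proportional over F and the kernel of d2 in F is not
    contained in that of d1 ([kernel_incl_proportional]). Let L be the kernel
    of d1 and v a slice, that is d1 v = 1. The time-one pullback sigma of the
    first action fixes L and sends v to v + 1, and F = L(v). Conjugation by
    sigma permutes the locally nilpotent derivations, hence K = FD(X) is stable
    under sigma. An element of K outside L makes v algebraic over K. If m is
    the monic minimal polynomial of v over K then m^sigma(T + 1) = m(T) by
    uniqueness; comparing the coefficients next to the leading one, sigma fixes
    a + deg(m) v for some a in K ([exists_translate_fixed]). The fixed elements
    of sigma lie in L, since a polynomial in the time variable that is constant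
    on the natural numbers is constant ([pullback_fixed]). So v is in K and
    K = F. This is [field_Derksen_full].

    Otherwise the tangent space at x, which the orbit tangents span, is zero or
    is the line tangent to the orbit of x under one action s. A function that
    vanishes at x and whose differential there is zero on the tangent space lies
    in the square of the maximal ideal m of x, by a double annihilator argument
    ([square_of_maximal_ideal]). If the tangent
    space is zero, m = m^2 and Nakayama's lemma makes X a point
    ([trivial_tangent_space_Derksen]). If it is a line, let
    phi : A -> C[t] be the restriction to the orbit of x. Its image is stable
    under d/dt and not reduced to constants, so phi q = t for some q
    ([phi_surjective]), and the kernel I of phi is generated by the finitely
    many functions coord i - phi (coord i) (q). Here I is contained in m^2 and
    m = I + q A, which gives I = m I; Nakayama's lemma yields I = 0, so X is
    isomorphic to the affine line ([orbit_isomorphic_to_line]), contrary to the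
    hypothesis. *)

Set Implicit Arguments.
Unset Strict Implicit.
Unset Printing Implicit Defensive.

Import GRing.Theory Num.Theory.
Local Open Scope ring_scope.
Local Open Scope classical_set_scope.
Local Open Scope quotient_scope.


(** * Derivations and morphisms of a fraction field *)

Section QuotientRule.
Variable K : fieldType.
Implicit Types a b : K.

(** Here da and db stand for the derivatives of a and b. They are free variables, so
    that well-definedness and the rules for sums and products are identities in
    an arbitrary field. *)
Definition quotient_rule a b da db := (da * b - a * db) / b ^+ 2.

Lemma quotient_rule_wd a b a' b' da db da' db' : b != 0 -> b' != 0 ->
  a * b' = a' * b -> da * b' + a * db' = da' * b + a' * db ->
  quotient_rule a b da db = quotient_rule a' b' da' db'.
Proof.
move=> b0 b'0 E1 E2.
have aE : a = a' * b / b' by rewrite -E1 mulfK.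
have daE : da = (da' * b + a' * db - a * db') / b' by rewrite -E2 addrK mulfK.
by rewrite /quotient_rule daE aE; field; rewrite ?b0 ?b'0.
Qed.

Lemma quotient_ruleD a b a' b' da db da' db' : b != 0 -> b' != 0 ->
  quotient_rule (a * b' + a' * b) (b * b')
    (da * b' + a * db' + (da' * b + a' * db)) (db * b' + b * db')
  = quotient_rule a b da db + quotient_rule a' b' da' db'.
Proof. by move=> b0 b'0; rewrite /quotient_rule; field; rewrite ?b0 ?b'0. Qed.

Lemma quotient_ruleM a b a' b' da db da' db' : b != 0 -> b' != 0 ->
  quotient_rule (a * a') (b * b') (da * a' + a * da') (db * b' + b * db')
  = quotient_rule a b da db * (a' / b') + a / b * quotient_rule a' b' da' db'.
Proof. by move=> b0 b'0; rewrite /quotient_rule; field; rewrite ?b0 ?b'0. Qed.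

Lemma quotient_rule_slice a b : b != 0 -> quotient_rule a b b 0 = 1.
Proof. by move=> b0; rewrite /quotient_rule; field. Qed.

Lemma addf_div_sub a b a' b' : b != 0 -> b' != 0 ->
  a / b - a' / b' = (a * b' - a' * b) / (b * b').
Proof. by move=> b0 b'0; field; rewrite ?b0 ?b'0. Qed.

Lemma derivation_quotient (D : K -> K) :
  (forall x y, D (x * y) = D x * y + x * D y) ->
  forall x y, y != 0 -> D (x / y) = quotient_rule x y (D x) (D y).
Proof.
move=> DM x y y0; have := DM (x / y) y.
by rewrite /quotient_rule divfK // => ->; field.
Qed.

End QuotientRule.

Section Fractions.
Variable A : idomainType.
Local Notation F := {fraction A}.
Local Notation "x %:F" := (FracField.tofrac x).

Lemma fracP (x : F) : exists a b, b != 0 /\ x = a%:F / b%:F.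
Proof.
elim/quotW: x => r; exists \n_r, \d_r; split; first exact: denom_ratioP.
have d0 := denom_ratioP r.
apply: (canRL (mulfK _)); rewrite ?tofrac_eq0 //.
unlock FracField.tofrac; rewrite -[LHS]FracField.pi_mul.
apply/eqmodP => /=; rewrite FracField.equivfE /FracField.mulf /=.
by rewrite !numden_Ratio ?oner_neq0 ?mulr1 // mulrC.
Qed.

Lemma frac_eqP (a b a' b' : A) : b != 0 -> b' != 0 ->
  (a%:F / b%:F = a'%:F / b'%:F) <-> (a * b' = a' * b).
Proof.
move=> b0 b'0; split=> [/eqP|E].
  by rewrite eqr_div ?tofrac_eq0 // -!tofracM tofrac_eq => /eqP.
by apply/eqP; rewrite eqr_div ?tofrac_eq0 // -!tofracM E.
Qed.

(** A fraction gets the value of [quotient_rule] on any of its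
    representatives; [quotient_rule_wd] makes the choice irrelevant. *)
Lemma derivation_frac (d : A -> A) :
  (forall a b, d (a + b) = d a + d b) ->
  (forall a b, d (a * b) = d a * b + a * d b) ->
  exists D : F -> F,
    [/\ forall x y, D (x + y) = D x + D y,
        forall x y, D (x * y) = D x * y + x * D y
      & forall a, D a%:F = (d a)%:F].
Proof.
move=> dD dM.
pose q a b := quotient_rule a%:F b%:F (d a)%:F (d b)%:F.
have d1 : d 1 = 0.
  by apply: (addrI (d 1)); have := dM 1 1; rewrite !mulr1 mul1r addr0.
have n0 (b : A) : b != 0 -> b%:F != 0 by rewrite tofrac_eq0.
have /choice[D DE] (x : F) : exists y : F,
    forall a b, b != 0 -> x = a%:F / b%:F -> y = q a b.
  have [a [b [b0 xE]]] := fracP x.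
  exists (q a b) => a' b' b'0; rewrite {x}xE => /frac_eqP E.
  have {}E := E b0 b'0.
  apply: quotient_rule_wd; rewrite ?n0 // -!tofracM ?E //.
  by rewrite -!tofracD -!dM E.
exists D; split=> [x y|x y|a].
- have [a [b [b0 xE]]] := fracP x; have [a' [b' [b'0 yE]]] := fracP y.
  rewrite (DE x a b) // (DE y a' b') // (DE _ (a * b' + a' * b) (b * b')) ?mulf_neq0 //.
    by rewrite /q !(dD, dM) !(tofracD, tofracM) quotient_ruleD ?n0.
  by rewrite xE yE !(tofracD, tofracM) addf_div ?n0.
- have [a [b [b0 xE]]] := fracP x; have [a' [b' [b'0 yE]]] := fracP y.
  rewrite (DE x a b) // (DE y a' b') // (DE _ (a * a') (b * b')) ?mulf_neq0 //.
    by rewrite /q !(dD, dM) !(tofracD, tofracM) quotient_ruleM ?n0 // xE yE.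
  by rewrite xE yE !tofracM mulf_div.
- rewrite (DE _ a 1) ?oner_neq0 ?tofrac1 ?divr1 // /q /quotient_rule d1.
  by rewrite tofrac0 tofrac1 mulr0 subr0 mulr1 expr1n divr1.
Qed.

Lemma rmorphism_frac (f : {rmorphism A -> A}) : injective f ->
  exists g : {rmorphism F -> F}, forall a, g a%:F = (f a)%:F.
Proof.
move=> fI.
have f0 b : b != 0 -> f b != 0 by rewrite -{2}(rmorph0 f) (inj_eq fI).
have n0 (b : A) : b != 0 -> b%:F != 0 by rewrite tofrac_eq0.
have /choice[g gE] (x : F) : exists y : F,
    forall a b, b != 0 -> x = a%:F / b%:F -> y = (f a)%:F / (f b)%:F.
  have [a [b [b0 xE]]] := fracP x.
  exists ((f a)%:F / (f b)%:F) => a' b' b'0; rewrite {x}xE => /frac_eqP E.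
  by apply/frac_eqP; rewrite ?f0 // -!rmorphM E.
have gA a : g a%:F = (f a)%:F.
  by rewrite (gE _ a 1) ?oner_neq0 ?rmorph1 ?tofrac1 ?divr1.
have gB : zmod_morphism g.
  move=> x y.
  have [a [b [b0 xE]]] := fracP x; have [a' [b' [b'0 yE]]] := fracP y.
  rewrite (gE x a b) // (gE y a' b') // (gE _ (a * b' - a' * b) (b * b')) ?mulf_neq0 //.
    by rewrite rmorphB !rmorphM tofracB !tofracM addf_div_sub ?n0 ?f0.
  by rewrite xE yE tofracB !tofracM addf_div_sub ?n0.
have gM : monoid_morphism g.
  split=> [|x y]; first by rewrite -tofrac1 gA rmorph1.
  have [a [b [b0 xE]]] := fracP x; have [a' [b' [b'0 yE]]] := fracP y.
  rewrite (gE x a b) // (gE y a' b') // (gE _ (a * a') (b * b')) ?mulf_neq0 //.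
    by rewrite !rmorphM mulf_div.
  by rewrite xE yE !tofracM mulf_div.
pose m1 := GRing.isZmodMorphism.Build _ _ g gB.
pose m2 := GRing.isMonoidMorphism.Build _ _ g gM.
pose G : {rmorphism F -> F} := HB.pack g m1 m2.
by exists G.
Qed.

End Fractions.

(** * Subfields stable under a translation *)

Section Subfields.
Variable F : fieldType.

Definition is_subfield (K : set F) : Prop :=
  [/\ K 1, forall x y, K x -> K y -> K (x - y),
      forall x y, K x -> K y -> K (x * y) & forall x, K x -> K x^-1].

Variable K : set F.
Hypothesis K_subfield : is_subfield K.

Lemma subfield1 : K 1. Proof. by case: K_subfield. Qed.

Lemma subfieldB x y : K x -> K y -> K (x - y).
Proof. by case: K_subfield => _ KB _ _; apply: KB. Qed.

Lemma subfieldM x y : K x -> K y -> K (x * y).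
Proof. by case: K_subfield => _ _ KM _; apply: KM. Qed.

Lemma subfieldV x : K x -> K x^-1.
Proof. by case: K_subfield => _ _ _; apply. Qed.

Lemma subfield0 : K 0.
Proof. by rewrite -(subrr 1); apply: subfieldB; apply: subfield1. Qed.

Lemma subfieldD x y : K x -> K y -> K (x + y).
Proof.
move=> Kx Ky; rewrite -[y]opprK -[- y]sub0r.
by do 2?apply: subfieldB => //; apply: subfield0.
Qed.

Lemma subfield_nat n : K n%:R.
Proof.
elim: n => [|n IH]; first exact: subfield0.
by rewrite mulrS; apply: subfieldD => //; apply: subfield1.
Qed.

Lemma subfield_sum (I : Type) (r : seq I) (P : pred I) (f : I -> F) :
  (forall i, P i -> K (f i)) -> K (\sum_(i <- r | P i) f i).
Proof. by apply: big_ind; [apply: subfield0 | apply: subfieldD]. Qed.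

Lemma subfield_horner (p : {poly F}) x :
  (forall i, K p`_i) -> K x -> K p.[x].
Proof.
move=> Kp Kx; elim/poly_ind: p Kp => [|p c IH] Kp.
  by rewrite horner0; apply: subfield0.
rewrite hornerMXaddC; apply: subfieldD; last first.
  by have := Kp 0%N; rewrite coefD coefMX coefC /= add0r.
apply: subfieldM => //; apply: IH => i.
by have := Kp i.+1; rewrite coefD coefMX coefC /= addr0.
Qed.

Variable (tau : {rmorphism F -> F}) (s : F).
Hypotheses (tauK : forall x, K x -> K (tau x)) (tau_s : tau s = s + 1).

Lemma coef_XaddC_exp (i n : nat) : (('X + 1 : {poly F}) ^+ i)`_n = 'C(i, n)%:R.
Proof.
rewrite addrC exprDn coef_sum.
under eq_bigr => j _ do rewrite expr1n mul1r coefMn coefXn.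
have [le_ni|lt_in] := leqP n i.
  rewrite (bigD1 (inord n)) //= inordK // eqxx big1 ?addr0 //.
  move=> j; rewrite -val_eqE /= inordK // eq_sym => /negPf ->.
  by rewrite mul0rn.
rewrite bin_small // big1 // => j _; case: eqP => [E|]; last by rewrite mul0rn.
by move: lt_in; rewrite E ltnNge -ltnS ltn_ord.
Qed.

(** Let m be the monic minimal polynomial of s over K and d its degree. The
    polynomial m^tau(T + 1) is also monic of degree d with coefficients in K,
    and it kills s because tau s = s + 1; so it equals m. Its coefficient of
    index d - 1 is tau a + d, where a is that of m: hence tau a + d = a, and
    a + d s is fixed by tau. *)
Lemma exists_translate_fixed (p : {poly F}) :
  p != 0 -> (forall i, K p`_i) -> root p s ->
  exists d a, [/\ (0 < d)%N, K a & tau (a + d%:R * s) = a + d%:R * s].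
Proof.
move=> p0 Kp ps.
pose vanishes k := `[< exists m : {poly F},
  [/\ size m = k, m != 0, forall i, K m`_i & root m s] >].
have ex : exists k, vanishes k by exists (size p); apply/asboolP; exists p.
have [k /asboolP[m [mk m0 Km ms]] kmin] := ex_minnP ex.
have {kmin} kmin (q : {poly F}) :
    (forall i, K q`_i) -> root q s -> (size q < k)%N -> q = 0.
  move=> Kq qs; apply: contraTeq => q0; rewrite -leqNgt; apply: kmin.
  by apply/asboolP; exists q.
have lc0 : lead_coef m != 0 by rewrite lead_coef_eq0.
pose n := (lead_coef m)^-1 *: m.
have nk : size n = k by rewrite size_scale ?invr_eq0.
have Kn i : K n`_i.
  by rewrite coefZ; apply: subfieldM => //; apply: subfieldV; apply: Km.
have ns : root n s by rewrite rootZ ?invr_eq0.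
have n_monic : lead_coef n = 1 by rewrite lead_coefZ mulVf.
have k_gt1 : (1 < k)%N.
  by rewrite -mk; apply: (root_size_gt1 m0 ms).
have [d dk] : exists d, k = d.+1 by exists k.-1; rewrite prednK // (ltn_trans _ k_gt1).
have d_gt0 : (0 < d)%N by move: k_gt1; rewrite dk.
have nd : n`_d = 1 by rewrite -n_monic lead_coefE nk dk.
pose q := map_poly tau n \Po ('X + 1).
have size_q : size q = k.
  by rewrite size_comp_poly2 ?size_XaddC // size_map_poly.
have qE i : q`_i = \sum_(j < k) tau n`_j * 'C(j, i)%:R.
  rewrite coef_comp_poly size_map_poly nk.
  by apply: eq_bigr => j _; rewrite coef_map coef_XaddC_exp.
have qd : q`_d = 1.
  rewrite qE dk big_ord_recr /= binn nd rmorph1 mulr1 big1 ?add0r //.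
  by move=> j _; rewrite bin_small ?ltn_ord // mulr0.
(* The difference has degree less than d and kills s. *)
have E : q - n = 0.
  apply: kmin.
  - move=> i; rewrite coefB; apply: subfieldB => //; rewrite qE.
    apply: subfield_sum => j _; apply: subfieldM; first exact: tauK.
    exact: subfield_nat.
  - rewrite /root hornerD hornerN (eqP ns) subr0 horner_comp hornerD hornerX.
    by rewrite hornerC -tau_s horner_map /= (eqP ns) rmorph0.
  - rewrite dk ltnS; apply/leq_sizeP => i; rewrite leq_eqVlt coefB => /orP[/eqP<-|].
      by rewrite qd nd subrr.
    by move=> di; rewrite !nth_default ?subrr // ?size_q ?nk dk.
move/subr0_eq: E => E.
exists d, n`_d.-1; split=> //.
rewrite rmorphD rmorphM rmorph_nat tau_s.
have := congr1 (fun p : {poly F} => p`_d.-1) E.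
rewrite qE dk big_ord_recr /= nd rmorph1 mul1r -(prednK d_gt0) /=.
rewrite big_ord_recr /= binn mulr1 big1 => [|j _]; last first.
  by rewrite bin_small ?ltn_ord // mulr0.
rewrite add0r -bin_sub // subSnn bin1 prednK // => nE.
by rewrite -[in RHS]nE mulrDr mulr1 addrA addrAC.
Qed.

End Subfields.

(** * Derivations with a slice *)

Section LocalSlice.
Variables (F : fieldType) (D : F -> F).
Hypotheses (DD : forall x y, D (x + y) = D x + D y)
  (DM : forall x y, D (x * y) = D x * y + x * D y).
Hypothesis char0 : forall n, n.+1%:R != 0 :> F.

Lemma derivation0 : D 0 = 0.
Proof. by apply: (addrI (D 0)); rewrite -DD !addr0. Qed.

Lemma derivation1 : D 1 = 0.
Proof. by apply: (addrI (D 1)); have := DM 1 1; rewrite !mulr1 mul1r addr0. Qed.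

Lemma derivationN x : D (- x) = - D x.
Proof. by apply: (addrI (D x)); rewrite -DD !subrr derivation0. Qed.

Lemma constants_subfield : is_subfield [set x | D x = 0].
Proof.
split=> /= [|x y Dx Dy|x y Dx Dy|x Dx]; first exact: derivation1.
- by rewrite DD derivationN Dx Dy subr0.
- by rewrite DM Dx Dy mul0r mulr0 addr0.
- have [->|x0] := eqVneq x 0; first by rewrite invr0 derivation0.
  have := DM x x^-1; rewrite mulfV // derivation1 Dx mul0r add0r => /esym/eqP.
  by rewrite mulf_eq0 (negPf x0) /= => /eqP.
Qed.

Variable s : F.
Hypothesis Ds : D s = 1.

Lemma derivationXn k : D (s ^+ k.+1) = k.+1%:R * s ^+ k.
Proof.
elim: k => [|k IH]; first by rewrite expr1 mulr1 Ds.
by rewrite exprS DM IH Ds [k.+2%:R]mulrS exprS; ring.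
Qed.

(** Taylor expansion along the slice: if c = D^k a is a constant, subtracting
    c s^k / k! from a lowers its order of nilpotency. *)
Lemma nilpotent_poly_slice k a : iter k D a = 0 ->
  exists p : {poly F}, (forall i, D p`_i = 0) /\ p.[s] = a.
Proof.
have D0 := derivation0.
have constM c x : D c = 0 -> D (c * x) = c * D x.
  by move=> c0; rewrite DM c0 mul0r add0r.
have constB x y : D (x - y) = D x - D y by rewrite DD derivationN.
elim: k a => [|k IH] a /= ka.
  by exists 0; split=> [i|]; rewrite ?coef0 ?horner0.
pose c := iter k D a.
pose b := a - c / k`!%:R * s ^+ k.
have f0 j : j`!%:R != 0 :> F by rewrite -(prednK (fact_gt0 j)).
have Dnat j : D j%:R = 0.
  by elim: j => [|j IHj]; rewrite ?mulrS ?DD ?derivation1 ?IHj ?addr0.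
have DV x : D x = 0 -> D x^-1 = 0 by case: constants_subfield => _ _ _; apply.
have Dcst x : D x = 0 -> D (c / x) = 0.
  by move=> Dx; rewrite DM ka mul0r DV // mulr0 addr0.
have itB j x y : iter j D (x - y) = iter j D x - iter j D y.
  by elim: j => //= j ->.
have itC j e x : D e = 0 -> iter j D (e * x) = e * iter j D x.
  by move=> De; elim: j => //= j ->; rewrite constM.
have itX j : iter j D (s ^+ j) = j`!%:R.
  elim: j => [|j IHj] //; rewrite iterSr derivationXn itC // IHj.
  by rewrite factS natrM.
have [p [Dp pb]] : exists p : {poly F}, (forall i, D p`_i = 0) /\ p.[s] = b.
  by apply: IH; rewrite itB itC ?Dcst // itX divfK // subrr.
exists (p + (c / k`!%:R) *: 'X^k); split=> [i|].
  rewrite coefD coefZ coefXn DD Dp add0r.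
  by case: (i == k); rewrite ?mulr0 // mulr1 Dcst.
by rewrite hornerD hornerZ hornerXn pb subrK.
Qed.

End LocalSlice.

Lemma derivation_horner (F : fieldType) (D : F -> F) :
  (forall x y, D (x + y) = D x + D y) ->
  (forall x y, D (x * y) = D x * y + x * D y) ->
  forall (p : {poly F}) x, (forall i, D p`_i = 0) ->
  D p.[x] = p^`().[x] * D x.
Proof.
move=> DD DM p x; elim/poly_ind: p => [|p c IH] Dp.
  by rewrite deriv0 horner0 mul0r (derivation0 DD).
have Dc : D c = 0 by have := Dp 0%N; rewrite coefD coefMX coefC /= add0r.
rewrite hornerMXaddC DD DM Dc addr0 IH => [|i]; last first.
  by have := Dp i.+1; rewrite coefD coefMX coefC /= addr0.
by rewrite derivD derivC addr0 derivM derivX mulr1 hornerD hornerMX; ring.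
Qed.

(** The last but one non-zero iterate of d on f. *)
Lemma nilpotent_local_slice (A : zmodType) (d : A -> A) f :
  d 0 = 0 -> d f != 0 -> (exists k, iter k d f = 0) ->
  exists g, d g != 0 /\ d (d g) = 0.
Proof.
move=> d0 df [k kf].
have ex : exists k, iter k d f == 0 by exists k; apply/eqP.
have [m /eqP mf mmin] := ex_minnP ex.
have iter_n0 i : (i < m)%N -> iter i d f != 0.
  by move=> im; apply: contraTneq im => E; rewrite -leqNgt mmin ?E.
case: m mf iter_n0 {mmin} => [|[|m]] mf iter_n0.
- by move: df; rewrite [f]mf d0 eqxx.
- by move: df; rewrite [d f]mf eqxx.
- by exists (iter m d f); rewrite -!iterS iter_n0.
Qed.

Section SliceInSubfield.
Variables (F : fieldType) (D : F -> F) (tau : {rmorphism F -> F}) (K : set F).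
Hypothesis char0 : forall n, n.+1%:R != 0 :> F.
Hypotheses (DD : forall x y, D (x + y) = D x + D y)
  (DM : forall x y, D (x * y) = D x * y + x * D y).
Hypothesis K_subfield : is_subfield K.
Hypothesis constantsK : forall x, D x = 0 -> K x.
Variable s : F.
Hypothesis Ds : D s = 1.

Lemma nilpotent_in_subfield k a : K s -> iter k D a = 0 -> K a.
Proof.
move=> Ks /(nilpotent_poly_slice DD DM char0 Ds)[p [Dp <-]].
by apply: subfield_horner => // i; apply: constantsK.
Qed.

Hypotheses (tauK : forall x, K x -> K (tau x)) (tau_s : tau s = s + 1).
Hypothesis tau_fixed : forall x, tau x = x -> D x = 0.

(** Write a = p(s) and b = q(s) with p and q over the constants. Then
    p - (a / b) q has its coefficients in K and kills s, and it is not zero since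
    otherwise a / b would be a quotient of constants. So s is algebraic over K
    and [exists_translate_fixed] gives c in K such that c + d s is fixed by tau,
    hence a constant, hence in K. *)
Lemma slice_in_subfield k l a b : iter k D a = 0 -> iter l D b = 0 ->
  b != 0 -> K (a / b) -> D (a / b) != 0 -> K s.
Proof.
move=> /(nilpotent_poly_slice DD DM char0 Ds)[p [Dp pa]].
move=> /(nilpotent_poly_slice DD DM char0 Ds)[q [Dq qb]] b0.
set h := a / b => Kh Dh.
have KP i : K p`_i by apply: constantsK.
have KQ i : K q`_i by apply: constantsK.
have r0 : p - h *: q != 0.
  apply: contraNneq Dh => /subr0_eq E.
  have q0 : q != 0 by apply: contraNneq b0 => q0; rewrite -qb q0 horner0.
  have lq0 : lead_coef q != 0 by rewrite lead_coef_eq0.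
  have -> : h = p`_(size q).-1 / lead_coef q by rewrite E coefZ -lead_coefE mulfK.
  have LF := constants_subfield DD DM.
  apply/eqP; apply: (subfieldM LF) => /=; first exact: Dp.
  by apply: (subfieldV LF); rewrite /= lead_coefE Dq.
have Kr i : K (p - h *: q)`_i.
  by rewrite coefB coefZ; apply: subfieldB => //; apply: subfieldM.
have rs : root (p - h *: q) s.
  by rewrite /root hornerD hornerN hornerZ pa qb divfK // subrr.
have [d [c [d0 Kc fix_c]]] := exists_translate_fixed K_subfield tauK tau_s r0 Kr rs.
have Kcs : K (c + d%:R * s) by apply: constantsK; apply: tau_fixed.
have dn0 : d%:R != 0 :> F by rewrite -(prednK d0).
have -> : s = ((c + d%:R * s) - c) / d%:R by rewrite [c + _]addrC addrK mulrC mulKf.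
apply: subfieldM => //; first exact: subfieldB.
by apply: subfieldV => //; apply: subfield_nat.
Qed.

End SliceInSubfield.

(** * Linear algebra and polynomials in several variables *)

(** Agreement on the natural numbers suffices: this turns invariance under one
    translation into invariance under the whole additive group. *)
Lemma poly_eq_nat (k : numDomainType) (p q : {poly k}) :
  (forall m : nat, p.[m%:R] = q.[m%:R]) -> p = q.
Proof.
move=> E; apply/eqP; rewrite -subr_eq0; apply/eqP.
pose r := p - q; pose rs := [seq i%:R : k | i <- iota 0 (size r)].
apply: (@roots_geq_poly_eq0 _ r rs).
- apply/allP => _ /mapP[m _ ->].
  by rewrite /root hornerD hornerN E subrr.
- by rewrite map_inj_uniq ?iota_uniq //; apply: mulrIn; rewrite oner_neq0.
- by rewrite size_map size_iota.
Qed.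

Lemma poly_eq_eval (k : numDomainType) (p q : {poly k}) :
  (forall t, p.[t] = q.[t]) -> p = q.
Proof. by move=> E; apply: poly_eq_nat. Qed.

(** The determinant trick. If M is the matrix of the coefficients e, the vector g
    is killed by 1 - M, hence by its determinant, which ev sends to 1. *)
Lemma nakayama_domain (A : idomainType) (k : comNzRingType)
    (ev : {rmorphism A -> k}) n (g : 'I_n -> A) :
  (forall i, exists2 e : 'I_n -> A,
     forall j, ev (e j) = 0 & g i = \sum_j e j * g j) ->
  forall i, g i = 0.
Proof.
move=> gP i.
have /choice[e eP] (j : 'I_n) : exists e : 'I_n -> A,
    (forall l, ev (e l) = 0) /\ g j = \sum_l e l * g l.
  by have [e ev_e gE] := gP j; exists e.
pose M : 'M[A]_n := 1%:M - \matrix_(i, j) e i j.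
pose G : 'cV[A]_n := \col_j g j.
have MG : M *m G = 0.
  apply/colP => j; rewrite mulmxBl mul1mx !mxE [g j](eP j).2.
  by apply/eqP; rewrite subr_eq0; apply/eqP/eq_bigr => l _; rewrite !mxE.
have detM : ev (\det M) = 1.
  rewrite -det_map_mx (_ : map_mx ev M = 1%:M) ?det1 //.
  by apply/matrixP => a b; rewrite !mxE rmorphB (eP a).1 subr0 rmorph_nat.
have detM0 : \det M != 0.
  by apply: contra_eq_neq detM => ->; rewrite rmorph0 eq_sym oner_neq0.
have : \det M *: G = 0 by rewrite -mul_scalar_mx -mul_adj_mx -mulmxA MG mulmx0.
move/colP/(_ i); rewrite !mxE => /eqP.
by rewrite mulf_eq0 (negPf detM0) => /eqP.
Qed.

(** V is only a set closed under linear combinations; it is the row space of a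
    matrix M with rows in V and of maximal rank, and the columns of [cokermx M]
    are linear forms that cut out this row space. *)
Lemma double_annihilator (k : fieldType) n (V : set 'rV[k]_n) (u : 'rV[k]_n) :
  V 0 -> (forall a v w, V v -> V w -> V (a *: v + w)) ->
  (forall w : 'rV[k]_n, (forall v, V v -> \sum_i v 0 i * w 0 i = 0) ->
     \sum_i u 0 i * w 0 i = 0) ->
  V u.
Proof.
move=> V0 VD uV.
pose spans r := `[< exists m (M : 'M[k]_(m, n)),
  (forall i, V (row i M)) /\ \rank M = r >].
have ex : exists r, spans r.
  exists 0%N; apply/asboolP; exists 0%N, 0; split; first by case.
  exact: mxrank0.
have ub r : spans r -> (r <= n)%N.
  by move=> /asboolP[m [M [_ <-]]]; apply: rank_leq_col.
have [r /asboolP[m [M [VM Mr]]] rmax] := ex_maxnP ex ub.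
have V_sub v : V v -> (v <= M)%MS.
  move=> Vv.
  have /rmax : spans (\rank (col_mx M v)).
    apply/asboolP; exists (m + 1)%N, (col_mx M v); split=> // i.
    case: (split_ordP i) => j ->; first by rewrite rowKu.
    by rewrite rowKd ord1 row_id.
  rewrite -Mr => le_r.
  have /eqmxP/eqmx_sym E : (M == col_mx M v)%MS.
    by rewrite -mxrank_leqif_eq ?eqn_leq ?le_r ?mxrankS // -addsmxE addsmxSl.
  by rewrite -E -addsmxE addsmxSr.
have : (u <= M)%MS.
  rewrite submxE; apply/eqP/rowP => j; rewrite !mxE.
  rewrite -[RHS](uV (col j (cokermx M))^T) => [|v /V_sub].
    by apply: eq_bigr => i _; rewrite !mxE.
  rewrite submxE => /eqP/rowP/(_ j).
  by rewrite !mxE => E; rewrite -[RHS]E; apply: eq_bigr => i _; rewrite !mxE.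
move=> /submxP[c ->]; rewrite mulmx_sum_row.
apply: (big_ind V) => // [v w Vv Vw|i _].
  by rewrite -[v]scale1r; apply: VD.
by rewrite -[_ *: _]addr0; apply: VD.
Qed.

Lemma mpoly_alg_ind n (k : comNzRingType) (P : {mpoly k[n]} -> Prop) :
  (forall c, P c%:MP) -> (forall i, P 'X_i) ->
  (forall p q, P p -> P q -> P (p + q)) ->
  (forall p q, P p -> P q -> P (p * q)) -> forall p, P p.
Proof.
move=> PC PX PD PM p; rewrite (mpolyE p).
apply: (big_ind P) => [||m _]; [exact: (PC 0) | exact: PD |].
rewrite -mul_mpolyC; apply: (PM) => //; rewrite mpolyXE_id.
apply: (big_ind P) => [||i _]; [exact: (PC 1) | exact: PM |].
by elim: (m i) => [|e IH]; rewrite ?expr0 ?exprS; [exact: (PC 1) | exact: PM].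
Qed.

(** Taylor expansion to order zero in an arbitrary algebra: modulo the
    differences a j - b j, substituting a or b gives the same result. *)
Lemma mmap_sub (k A : comNzRingType) (f : {rmorphism k -> A}) n
    (a b : 'I_n -> A) (p : {mpoly k[n]}) :
  exists c : 'I_n -> A, mmap f a p - mmap f b p = \sum_j c j * (a j - b j).
Proof.
elim/mpoly_alg_ind: p => [c|i|p q [c E] [e E']|p q [c E] [e E']].
- exists (fun=> 0); rewrite !mmapC subrr big1 // => j _; exact: mul0r.
- exists (fun j => (j == i)%:R); rewrite !mmapX !mmap1U (bigD1 i) //= eqxx mul1r.
  by rewrite big1 ?addr0 // => j /negPf ->; rewrite mul0r.
- exists (fun j => c j + e j); rewrite !mmapD.
  under eq_bigr do rewrite mulrDl.
  by rewrite big_split /= -E -E'; ring.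
- exists (fun j => c j * mmap f a q + mmap f b p * e j); rewrite !rmorphM /=.
  under eq_bigr => j _ do rewrite mulrDl mulrAC -[mmap f b p * e j * _]mulrA.
  rewrite big_split /= -mulr_suml -mulr_sumr -E -E'; ring.
Qed.

Lemma mmap_mpolyC_meval (k : comNzRingType) n (v : 'I_n -> k) (p : {mpoly k[n]}) :
  mmap (@mpolyC n k) (fun i => (v i)%:MP) p = (p.@[v])%:MP :> {mpoly k[n]}.
Proof.
elim/mpoly_alg_ind: p => [c|i|p q Ep Eq|p q Ep Eq].
- by rewrite mmapC mevalC.
- by rewrite mmapX mmap1U mevalXU.
- by rewrite mmapD mevalD mpolyCD Ep Eq.
- by rewrite (rmorphM (mmap _ _)) mevalM mpolyCM /= Ep Eq.
Qed.

Lemma mmap_mpolyC_id (k : comNzRingType) n (p : {mpoly k[n]}) :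
  mmap (@mpolyC n k) (fun i => 'X_i) p = p.
Proof.
elim/mpoly_alg_ind: p => [c|i|p q Ep Eq|p q Ep Eq].
- by rewrite mmapC.
- by rewrite mmapX mmap1U.
- by rewrite mmapD Ep Eq.
- by rewrite (rmorphM (mmap _ _)) /= Ep Eq.
Qed.

Lemma mderivU (k : comNzRingType) n (i j : 'I_n) :
  ('X_j)^`M(i) = (j == i)%:R :> {mpoly k[n]}.
Proof.
rewrite mderivX mnmE; case: eqP => [->|_]; last by rewrite scale0r.
by rewrite scale1r -[X in (X - _)%MM]add0m addmK mpolyX0.
Qed.

Lemma mpoly_taylor1 (k : comNzRingType) n (v : 'I_n -> k) (p : {mpoly k[n]}) :
  exists2 a : 'I_n -> {mpoly k[n]},
    p = (p.@[v])%:MP + \sum_j a j * ('X_j - (v j)%:MP)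
    & forall j, (a j).@[v] = (p^`M(j)).@[v].
Proof.
have [a] := mmap_sub (@mpolyC n k) (fun i => 'X_i) (fun i => (v i)%:MP) p.
rewrite mmap_mpolyC_id mmap_mpolyC_meval => E.
have pE : p = (p.@[v])%:MP + \sum_j a j * ('X_j - (v j)%:MP).
  by rewrite -E addrC subrK.
exists a => // i; rewrite [in RHS]pE mderivD mderivC add0r.
rewrite (raddf_sum (mderiv i)) /= (raddf_sum (meval v)) /=.
rewrite (bigD1 i) //= big1 => [|j ji]; last first.
  rewrite mderivM mevalD !mevalM !mevalB mevalXU mevalC subrr mulr0 add0r.
  by rewrite mderivB mderivC subr0 mderivU (negPf ji) meval0 mulr0.
rewrite addr0 mderivM mevalD !mevalM !mevalB mevalXU mevalC subrr mulr0 add0r.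
by rewrite mderivB mderivC subr0 mderivU eqxx meval1 mulr1.
Qed.

(** This and [retraction_horner] compute point values of polynomial expressions
    in an abstract algebra A of functions, f being the inclusion of the
    constants and g the value at a point. *)
Lemma retraction_mmap (k A : comNzRingType) (f : {rmorphism k -> A})
    (g : {rmorphism A -> k}) n (h : 'I_n -> A) (p : {mpoly k[n]}) :
  cancel f g -> g (mmap f h p) = p.@[fun i => g (h i)].
Proof.
move=> fK; elim/mpoly_alg_ind: p => [c|i|p q Ep Eq|p q Ep Eq].
- by rewrite mmapC mevalC fK.
- by rewrite mmapX mmap1U mevalXU.
- by rewrite mmapD mevalD rmorphD Ep Eq.
- by rewrite (rmorphM (mmap _ _)) mevalM rmorphM /= Ep Eq.
Qed.

Lemma retraction_horner (k A : comNzRingType) (f : {rmorphism k -> A})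
    (g : {rmorphism A -> k}) (p : {poly k}) (a : A) :
  cancel f g -> g (map_poly f p).[a] = p.[g a].
Proof.
move=> fK; rewrite -horner_map -map_poly_comp map_poly_id // => b _ /=.
exact: fK.
Qed.

Lemma horner_mmap (k : comNzRingType) n (h : 'I_n -> {poly k})
    (p : {mpoly k[n]}) t :
  (mmap polyC h p).[t] = p.@[fun i => (h i).[t]].
Proof.
elim/mpoly_alg_ind: p => [c|i|p q Ep Eq|p q Ep Eq].
- by rewrite mmapC mevalC hornerC.
- by rewrite mmapX mmap1U mevalXU.
- by rewrite mmapD mevalD hornerD Ep Eq.
- by rewrite (rmorphM (mmap _ _)) mevalM hornerM /= Ep Eq.
Qed.

Lemma deriv_mmap (k : comNzRingType) n (h : 'I_n -> {poly k}) (p : {mpoly k[n]}) :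
  (mmap polyC h p)^`() = \sum_i mmap polyC h p^`M(i) * (h i)^`().
Proof.
elim/mpoly_alg_ind: p => [a|i|p q Ep Eq|p q Ep Eq].
- by rewrite mmapC derivC big1 // => i _; rewrite mderivC mmap0 mul0r.
- rewrite mmapX mmap1U (bigD1 i) //= mderivU eqxx (rmorph1 (mmap _ _)) mul1r.
  rewrite big1 ?addr0 // => j ji.
  by rewrite mderivU eq_sym (negPf ji) mmap0 mul0r.
- rewrite mmapD derivD Ep Eq -big_split /=.
  by apply: eq_bigr => i _; rewrite mderivD mmapD mulrDl.
- rewrite (rmorphM (mmap _ _)) derivM /= Ep Eq mulr_suml mulr_sumr -big_split /=.
  apply: eq_bigr => i _; rewrite mderivM mmapD !(rmorphM (mmap _ _)) /= mulrDl.
  by rewrite mulrAC mulrA.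
Qed.

(** * Points, additive actions and their generators *)

Section CoordinateRing.
Variables (R : realType) (X : affine_variety R).
Local Notation C := R[i].
Local Notation n := (ambient_dim X).
Local Notation A := (coordinate_ring X).
Local Notation P := {mpoly C[n]}.

Definition point_of := {x : 'rV[C]_n | points X x}.

Lemma point_inj (x y : point_of) : sval x = sval y -> x = y.
Proof. by case: x y => [x Xx] [y Xy] /= xy; apply: eq_exist. Qed.

(** The polynomial representing f is determined up to an element of the vanishing
    ideal, so its value at a point of X depends on f only. Elements of the
    coordinate ring are compared through their values, by [value_inj]. *)
Definition value (x : point_of) (f : A) : C := (repr f).@[sval x 0].

Definition restr (p : P) : A := \pi_(coordinate_ring X) p.

HB.instance Definition _ := GRing.RMorphism.copy restr (\pi_(coordinate_ring X)).

Lemma coordinate_constE c : coordinate_const X c = restr c%:MP.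
Proof. by []. Qed.

HB.instance Definition _ :=
  GRing.RMorphism.copy (@coordinate_const R X) (restr \o @mpolyC n C).

HB.instance Definition _ := GRing.RMorphism.copy (@ratf R X) (@FracField.tofrac A).

Lemma restr_surj (f : A) : exists p, restr p = f.
Proof. by exists (repr f); exact: reprK. Qed.

Lemma value_restr x p : value x (restr p) = p.@[sval x 0].
Proof.
rewrite /value.
have : restr (repr (restr p)) == restr p by rewrite /restr reprK.
rewrite /restr -Quotient.idealrBE => /vanishing_idealP/(_ _ (svalP x)).
by rewrite mevalB => /subr0_eq.
Qed.

Lemma value_inj (f g : A) : (forall x, value x f = value x g) -> f = g.
Proof.
move=> E; rewrite -(reprK f) -(reprK g); apply/eqP.
rewrite -Quotient.idealrBE; apply/vanishing_idealP => x Xx.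
by rewrite mevalB; apply/eqP; rewrite subr_eq0; apply/eqP; apply: (E (exist _ x Xx)).
Qed.

Lemma value_is_zmod_morphism x : zmod_morphism (value x).
Proof.
move=> f g; have [p <-] := restr_surj f; have [q <-] := restr_surj g.
by rewrite -rmorphB !value_restr mevalB.
Qed.

Lemma value_is_monoid_morphism x : monoid_morphism (value x).
Proof.
split=> [|f g]; first by rewrite -(rmorph1 restr) value_restr meval1.
have [p <-] := restr_surj f; have [q <-] := restr_surj g.
by rewrite -rmorphM !value_restr mevalM.
Qed.

HB.instance Definition _ x :=
  GRing.isZmodMorphism.Build _ _ (value x) (value_is_zmod_morphism x).
HB.instance Definition _ x :=
  GRing.isMonoidMorphism.Build _ _ (value x) (value_is_monoid_morphism x).

Lemma valueD x f g : value x (f + g) = value x f + value x g.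
Proof. exact: (rmorphD (value x)). Qed.

Lemma valueB x f g : value x (f - g) = value x f - value x g.
Proof. exact: (rmorphB (value x)). Qed.

Lemma valueM x f g : value x (f * g) = value x f * value x g.
Proof. exact: (rmorphM (value x)). Qed.

Lemma value0 x : value x 0 = 0.
Proof. exact: (rmorph0 (value x)). Qed.

Lemma value_const x c : value x (coordinate_const X c) = c.
Proof. by rewrite coordinate_constE value_restr mevalC. Qed.

Lemma function_field_char0 m : m.+1%:R != 0 :> function_field X.
Proof.
have [x Xx] := points_nonempty X.
rewrite -(rmorph_nat (@ratf R X)) tofrac_eq0.
apply: contraTneq (isT) => E; have := congr1 (value (exist _ x Xx)) E.
by rewrite rmorph_nat rmorph0 => /eqP; rewrite pnatr_eq0.
Qed.

Section Action.
Variable s : 'I_n -> {poly P}.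
Hypothesis s_act : additive_action s.

Definition flow (t : C) (y : point_of) : point_of.
exists (act s t (sval y)).
abstract (by case: s_act => sX _ _; apply/sX/svalP).
Defined.

Lemma flow0 y : flow 0 y = y.
Proof. by apply: point_inj; case: s_act => _ + _; apply; exact: svalP. Qed.

Lemma flowD t u y : flow (t + u) y = flow t (flow u y).
Proof. by apply: point_inj; case: s_act => _ _; apply; exact: svalP. Qed.

(** The comorphism of the action, p(x) |-> p(s(t, x)). It is sealed, as is
    [along], to keep conversion from unfolding polynomial arithmetic. *)
Fact coaction_key : unit. Proof. exact: tt. Qed.
Definition coaction : P -> {poly P} :=
  locked_with coaction_key (mmap (polyC \o @mpolyC n C) s).

Lemma coaction_unlock : coaction = mmap (polyC \o @mpolyC n C) s.
Proof. exact: unlock. Qed.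

Lemma coactionE p (y : 'rV[C]_n) t :
  (map_poly (meval (y 0)) (coaction p)).[t] = p.@[act s t y 0].
Proof.
rewrite coaction_unlock; elim/mpoly_alg_ind: p => [c|i|p q Ep Eq|p q Ep Eq].
- by rewrite mmapC /= map_polyC hornerC /= !mevalC.
- by rewrite mmapX mmap1U mevalXU mxE.
- rewrite mmapD (rmorphD (map_poly (meval (y 0)))) hornerD mevalD.
  exact: congr2 Ep Eq.
- rewrite (rmorphM (mmap _ s)) (rmorphM (map_poly (meval (y 0)))) hornerM mevalM.
  exact: congr2 Ep Eq.
Qed.

(** The restriction of f to the orbit of y, as a polynomial in the time
    variable. *)
Definition along_def (y : point_of) (f : A) : {poly C} :=
  map_poly (meval (sval y 0)) (coaction (repr f)).

Fact along_key : unit. Proof. exact: tt. Qed.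
Definition along := locked_with along_key along_def.

Lemma along_unlock y f : along y f = along_def y f.
Proof. by rewrite /along unlock. Qed.

Lemma alongE y f t : (along y f).[t] = value (flow t y) f.
Proof. by rewrite along_unlock; exact: coactionE. Qed.

Lemma along_coef y f i :
  (along y f)`_i = ((coaction (repr f))`_i).@[sval y 0].
Proof. by rewrite along_unlock coef_map. Qed.

Lemma size_along y f : (size (along y f) <= size (coaction (repr f)))%N.
Proof. by rewrite along_unlock size_poly. Qed.

Lemma along_mpoly y f t :
  (along y f).[t] = ((coaction (repr f)).[t%:MP]).@[sval y 0].
Proof. by rewrite along_unlock -[in LHS](mevalC (sval y 0) t) horner_map. Qed.

Lemma along0 y f : (along y f).[0] = value y f.
Proof. by rewrite alongE flow0. Qed.

Lemma along_is_zmod_morphism y : zmod_morphism (along y).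
Proof.
move=> f g; apply: poly_eq_eval => t.
rewrite hornerD. rewrite hornerN. rewrite !alongE. by rewrite (rmorphB (value _)).
Qed.

Lemma along_is_monoid_morphism y : monoid_morphism (along y).
Proof.
split=> [|f g]; apply: poly_eq_eval => t; last by rewrite hornerM !alongE rmorphM.
by rewrite alongE rmorph1 hornerC.
Qed.

HB.instance Definition _ y :=
  GRing.isZmodMorphism.Build _ _ (along y) (along_is_zmod_morphism y).
HB.instance Definition _ y :=
  GRing.isMonoidMorphism.Build _ _ (along y) (along_is_monoid_morphism y).

Lemma alongD y f g : along y (f + g) = along y f + along y g.
Proof. exact: (rmorphD (along y)). Qed.

Definition along_rmorphism y : {rmorphism A -> {poly C}} := along y.

Lemma alongM y f g : along y (f * g) = along y f * along y g.
Proof. exact: (rmorphM (along y)). Qed.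

Lemma along_const y c : along y (coordinate_const X c) = c%:P.
Proof.
by apply: poly_eq_eval => t; rewrite alongE value_const hornerC.
Qed.

(** The addition law of the action. *)
Lemma along_flow u y f : along (flow u y) f = along y f \Po ('X + u%:P).
Proof.
apply: poly_eq_eval => t.
by rewrite horner_comp !(hornerD, hornerX, hornerC) !alongE flowD.
Qed.

(** The derivative of f along the orbits at time zero. *)
Definition generator (f : A) : A := restr (coaction (repr f))`_1.

Lemma value_generator y f : value y (generator f) = (along y f)^`().[0].
Proof.
by rewrite /generator value_restr horner_coef0 coef_deriv mulr1n along_coef.
Qed.

(** Differentiating at time zero at each point of the orbit is differentiating
    with respect to time, by [along_flow]. *)
Lemma along_generator y f : along y (generator f) = (along y f)^`().
Proof.
apply: poly_eq_eval => u; rewrite alongE value_generator along_flow deriv_comp.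
rewrite derivD derivX derivC addr0 mulr1 horner_comp.
by rewrite !(hornerD, hornerX, hornerC) add0r.
Qed.

Lemma along_iter_generator y k f :
  along y (iter k generator f) = (along y f)^`(k).
Proof. by elim: k => [|k IH] //; rewrite iterS along_generator IH derivnS. Qed.

(** Nilpotency is uniform in y: the degree of [along y f] is bounded by that of
    the coaction on a representative of f. *)
Lemma generator_lnd : locally_nilpotent_derivation generator.
Proof.
split; first split=> [f g|f g|c].
- apply: value_inj => y.
  by rewrite valueD !value_generator alongD derivD hornerD.
- apply: value_inj => y; rewrite valueD !valueM !value_generator alongM.
  by rewrite derivM hornerD !hornerM !along0.
- apply: value_inj => y.
  by rewrite value_generator along_const derivC horner0 value0.
- move=> f; exists (size (coaction (repr f))); apply: value_inj => y.
  rewrite -along0 along_iter_generator derivn_poly0 ?horner0 ?value0 //.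
  exact: size_along.
Qed.

(** This is exp(t d), where d is the generator of the action. *)
Definition pullback t (f : A) : A := restr (coaction (repr f)).[t%:MP].

Lemma value_pullback t y f : value y (pullback t f) = value (flow t y) f.
Proof.
by rewrite -alongE along_mpoly /pullback value_restr.
Qed.

Lemma pullback_is_zmod_morphism t : zmod_morphism (pullback t).
Proof.
move=> f g; apply: value_inj => y.
by rewrite (rmorphB (value y)) /= !value_pullback (rmorphB (value _)).
Qed.

Lemma pullback_is_monoid_morphism t : monoid_morphism (pullback t).
Proof.
split=> [|f g]; apply: value_inj => y.
  by rewrite value_pullback (rmorph1 (value _)) (rmorph1 (value y)).
by rewrite valueM !value_pullback valueM.
Qed.

HB.instance Definition _ t :=
  GRing.isZmodMorphism.Build _ _ (pullback t) (pullback_is_zmod_morphism t).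
HB.instance Definition _ t :=
  GRing.isMonoidMorphism.Build _ _ (pullback t) (pullback_is_monoid_morphism t).

Definition pullback_rmorphism t : {rmorphism A -> A} := pullback t.

Lemma pullbackK t : cancel (pullback t) (pullback (- t)).
Proof.
by move=> f; apply: value_inj => y; rewrite !value_pullback -flowD subrr flow0.
Qed.

Lemma pullback_const t c : pullback t (coordinate_const X c) = coordinate_const X c.
Proof. by apply: value_inj => y; rewrite value_pullback !value_const. Qed.

(** The exponential series stops after two terms. *)
Lemma pullback_slice f : generator (generator f) = 0 ->
  pullback 1 f = f + generator f.
Proof.
move=> ddf; apply: value_inj => y.
rewrite value_pullback valueD value_generator -alongE -along0 //.
have := along_generator y (generator f).
rewrite ddf (rmorph0 (along y)) along_generator.
move: (along y f) => p /esym p2.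
have -> : p = (p`_0)%:P + p`_1 *: 'X.
  apply/polyP => [[|[|i]]]; rewrite coefD coefC coefZ coefX /=.
  - by rewrite mulr0 addr0.
  - by rewrite add0r mulr1.
  - have /eqP := congr1 (fun q : {poly C} => q`_i) p2.
    rewrite !coef_deriv coef0 mulrn_eq0 /= mulrn_eq0 /= => /eqP ->.
    by rewrite mulr0 addr0.
rewrite derivD derivC derivZ derivX.
by rewrite !(hornerD, hornerC, hornerZ, hornerX) !mulr1 mulr0 addr0 add0r.
Qed.

Lemma pullback_nat m f : pullback m%:R f = iter m (pullback 1) f.
Proof.
apply: value_inj => y; elim: m y => [|m IH] y.
  by rewrite value_pullback flow0.
by rewrite iterS !value_pullback -IH value_pullback -flowD -addn1 natrD.
Qed.

(** If the fraction a / b is fixed by the time-one pullback, it is fixed at all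
    natural times. Along each orbit this is a polynomial identity in the time
    variable, whose derivative at zero says that d (a / b) = 0. *)
Lemma pullback_fixed a b : b != 0 -> pullback 1 a * b = a * pullback 1 b ->
  generator a * b = a * generator b.
Proof.
move=> b0 E.
have Em m : pullback m%:R a * b = a * pullback m%:R b.
  rewrite !pullback_nat; elim: m => // m IH; rewrite !iterS.
  have sb0 : pullback 1 b != 0.
    by rewrite -(rmorph0 (pullback 1)) (inj_eq (can_inj (pullbackK 1))).
  have IH1 : pullback 1 (iter m (pullback 1) a) * pullback 1 b =
      pullback 1 a * pullback 1 (iter m (pullback 1) b).
    by rewrite -!(rmorphM (pullback 1)) /= IH.
  by apply: (mulIf sb0); rewrite mulrAC IH1 mulrAC E mulrAC.
apply: value_inj => y; rewrite !valueM !value_generator.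
have : along y a * (value y b)%:P = (value y a)%:P * along y b.
  apply: poly_eq_nat => m; rewrite !hornerM !hornerC !alongE.
  by rewrite -!value_pullback -!valueM Em.
move/(congr1 (fun p : {poly C} => p^`().[0])).
by rewrite !derivM !derivC mulr0 mul0r addr0 add0r !hornerM !hornerC.
Qed.

End Action.
End CoordinateRing.

(** * Two actions with different kernels *)

Lemma conjugate_derivation (A : comNzRingType) (f g : {rmorphism A -> A})
    (e : A -> A) : cancel g f ->
  (forall a b, e (a + b) = e a + e b) ->
  (forall a b, e (a * b) = e a * b + a * e b) ->
  (forall a b, f (e (g (a + b))) = f (e (g a)) + f (e (g b))) /\
  (forall a b, f (e (g (a * b))) = f (e (g a)) * b + a * f (e (g b))).
Proof.
move=> fgK eD eM; split=> a b; first by rewrite !rmorphD eD !rmorphD.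
by rewrite rmorphM eM rmorphD !rmorphM !fgK.
Qed.

Lemma iter_conjugate (T : Type) (f g e : T -> T) k x : cancel f g -> cancel g f ->
  iter k (f \o e \o g) x = f (iter k e (g x)).
Proof. by move=> fK gK; elim: k => [|k IH] /=; rewrite ?gK // IH fK. Qed.

Section Derksen.
Variables (R : realType) (X : affine_variety R).
Local Notation C := R[i].
Local Notation n := (ambient_dim X).
Local Notation A := (coordinate_ring X).
Local Notation F := (function_field X).
Local Notation P := {mpoly C[n]}.

Lemma extend_derivation (d : A -> A) : derivation (@coordinate_const R X) d ->
  exists D : F -> F, [/\ forall x y, D (x + y) = D x + D y,
    forall x y, D (x * y) = D x * y + x * D y,
    forall f, D (ratf f) = ratf (d f) & derivation (@ratf_const R X) D].
Proof.
move=> [dD dM dC]; have [D [DD DM DE]] := derivation_frac dD dM.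
exists D; split=> //; split=> // c.
by rewrite /ratf_const [D _]DE dC tofrac0.
Qed.

Lemma ratf0 : ratf (0 : A) = 0.
Proof. exact: tofrac0. Qed.

Lemma ratfM (a b : A) : ratf (a * b) = ratf a * ratf b.
Proof. exact: tofracM. Qed.

Lemma ratf_inj : injective (@ratf R X).
Proof. by move=> a b /eqP; rewrite tofrac_eq => /eqP. Qed.

Lemma ratf_neq0 (a : A) : (ratf a != 0) = (a != 0).
Proof. by rewrite tofrac_eq0. Qed.

Lemma derivation_fracE (d : A -> A) (D : F -> F) a b :
  (forall x y, D (x * y) = D x * y + x * D y) ->
  (forall f, D (ratf f) = ratf (d f)) -> b != 0 ->
  (D (ratf a / ratf b) = 0) <-> (d a * b = a * d b).
Proof.
move=> DM DE b0; have rb0 : ratf b != 0 by rewrite ratf_neq0.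
rewrite (derivation_quotient DM) // /quotient_rule !DE -!tofracM -tofracB.
split=> [/eqP|->]; last by rewrite subrr tofrac0 mul0r.
rewrite mulf_eq0 invr_eq0 expf_eq0 /= (negPf rb0) orbF tofrac_eq0.
by rewrite subr_eq0 => /eqP.
Qed.

(** The kernel of the extended derivation can be tested in the coordinate ring,
    without mentioning the extension. *)
Lemma field_kernel_fracP (d : A -> A) a b :
  derivation (@coordinate_const R X) d -> b != 0 ->
  field_kernel d (ratf a / ratf b) <-> d a * b = a * d b.
Proof.
move=> dd b0; split=> [[D [[_ DM _] DE D0]]|E].
  by apply/(derivation_fracE _ DM DE b0).
have [D [DD DM DE DC]] := extend_derivation dd.
by exists D; split=> //; apply/(derivation_fracE _ DM DE b0).
Qed.

Lemma subfield_over_C_is_subfield (K : set F) : subfield_over_C K -> is_subfield K.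
Proof.
by case=> KC KB KM KV; split=> //; have := KC 1; rewrite /ratf_const !rmorph1.
Qed.

Lemma field_Derksen_subfield : subfield_over_C (field_Derksen X).
Proof.
split=> [c|f g Kf Kg|f g Kf Kg|f Kf] K [Ksub KG]; case: (Ksub) => KC KB KM KV.
- exact: KC.
- by apply: KB; [apply: Kf | apply: Kg].
- by apply: KM; [apply: Kf | apply: Kg].
- by apply: KV; apply: Kf.
Qed.

Lemma kernel_sub_Derksen d h : locally_nilpotent_derivation d ->
  (exists f : A, d f != 0) -> field_kernel d h -> field_Derksen X h.
Proof. by move=> dl dn dh K [_]; apply; exists d. Qed.

Lemma iter_ratf (d : A -> A) (D : F -> F) k a :
  (forall f, D (ratf f) = ratf (d f)) -> iter k D (ratf a) = ratf (iter k d a).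
Proof. by move=> DE; elim: k => //= k ->. Qed.

Lemma local_slice (d : A -> A) : locally_nilpotent_derivation d ->
  (exists f : A, d f != 0) -> exists f, d f != 0 /\ d (d f) = 0.
Proof.
move=> [[dD dM dC] dn] [f df]; apply: (nilpotent_local_slice _ df (dn f)).
by apply: (addrI (d 0)); rewrite -dD !addr0.
Qed.

Lemma slice_derivation (d : A -> A) (D : F -> F) f :
  (forall x y, D (x * y) = D x * y + x * D y) ->
  (forall f, D (ratf f) = ratf (d f)) -> d f != 0 -> d (d f) = 0 ->
  D (ratf f / ratf (d f)) = 1.
Proof.
move=> DM DE df ddf; have rdf : ratf (d f) != 0 by rewrite ratf_neq0.
by rewrite (derivation_quotient DM) // !DE ddf ratf0 quotient_rule_slice.
Qed.

(** Let s be a slice of the extension E of e. Every function is a polynomial in s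
    over the kernel of E, which the extension D of d also kills; hence
    D = D(s) E on functions, and the 2 x 2 minors of d and e vanish. *)
Lemma kernel_incl_proportional (d e : A -> A) :
  derivation (@coordinate_const R X) d -> locally_nilpotent_derivation e ->
  (exists f : A, e f != 0) ->
  field_kernel e `<=` field_kernel d ->
  forall f g, d f * e g = d g * e f.
Proof.
move=> dd el en sub f g; have [ed enil] := el.
have [D [DD DM DE DC]] := extend_derivation dd.
have [E [ED EM EE EC]] := extend_derivation ed.
have [u [eu eeu]] := local_slice el en.
pose s := ratf u / ratf (e u).
have Es : E s = 1 by apply: (slice_derivation EM EE).
have subDE x : E x = 0 -> D x = 0.
  move=> Ex; have : field_kernel e x by exists E.
  have [a [b [b0 ->]]] := fracP x.
  move=> /sub/(field_kernel_fracP _ dd b0) H.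
  exact/(derivation_fracE _ DM DE b0).
have prop a : D (ratf a) = E (ratf a) * D s.
  have [k ka] := enil a.
  have ka' : iter k E (ratf a) = 0 by rewrite (iter_ratf _ _ EE) ka ratf0.
  have [p [Ep <-]] := nilpotent_poly_slice ED EM (function_field_char0 X) Es ka'.
  rewrite (derivation_horner DD DM) => [|i]; last exact: subDE.
  by rewrite (derivation_horner ED EM) // Es mulr1.
apply: ratf_inj; rewrite !ratfM -!DE -!EE !prop.
by rewrite mulrAC [RHS]mulrAC (mulrC (E (ratf f))).
Qed.

Section TwoActions.
Variable s : 'I_n -> {poly P}.
Hypothesis s_act : additive_action s.
Local Notation d := (@generator R X s).
Let sigma := pullback_rmorphism s_act 1.
Let sigma' := pullback_rmorphism s_act (-1).
Let sigmaK : cancel sigma sigma' := pullbackK s_act 1.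

Lemma conjugate_lnd (e : A -> A) : locally_nilpotent_derivation e ->
  locally_nilpotent_derivation (sigma \o e \o sigma').
Proof.
have sigma'K : cancel sigma' sigma.
  by move=> f; rewrite -[RHS](pullbackK s_act (-1)) opprK.
move=> [[eD eM eC] en].
have [e'D e'M] := conjugate_derivation sigma'K eD eM.
split; first split=> [||c /=].
- exact: e'D.
- exact: e'M.
- by rewrite [sigma' _]pullback_const // eC (rmorph0 sigma).
- move=> f; have [k kf] := en (sigma' f); exists k.
  by rewrite (iter_conjugate _ _ _ sigmaK) // kf (rmorph0 sigma).
Qed.

Let sigma_neq0 a : (sigma a != 0) = (a != 0).
Proof. by rewrite -[in LHS](rmorph0 sigma) (inj_eq (can_inj sigmaK)). Qed.

(** The preimage of FD(X) under tau is a subfield. It contains the kernel of each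
    non-zero locally nilpotent derivation e, since tau maps that kernel into the
    kernel of the conjugate of e by sigma. *)
Lemma field_Derksen_stable (tau : {rmorphism F -> F}) :
  (forall f, tau (ratf f) = ratf (sigma f)) ->
  forall x, field_Derksen X x -> field_Derksen X (tau x).
Proof.
move=> tauE.
have [KC KB KM KV] := field_Derksen_subfield.
apply: smallest_sub => [|h [e [el [f ef] eh]]].
  split=> [c|f g|f g|f] /=.
  - by rewrite /ratf_const tauE [sigma _]pullback_const //; exact: KC.
  - by rewrite rmorphB; apply: KB.
  - by rewrite rmorphM; apply: KM.
  - by rewrite fmorphV; apply: KV.
have el' := conjugate_lnd el.
apply: (kernel_sub_Derksen el').
  by exists (sigma f); rewrite /= sigmaK sigma_neq0.
have [a [b [b0 hE]]] := fracP h.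
move: eh; rewrite hE => /(field_kernel_fracP _ el.1 b0) E.
rewrite rmorphM fmorphV /= [tau _]tauE [tau (FracField.tofrac b)]tauE.
apply/(field_kernel_fracP _ el'.1); first by rewrite sigma_neq0.
by rewrite /= !sigmaK -!(rmorphM sigma) /= E.
Qed.

(** As FD(X) contains the kernel of d, is stable under tau and contains h, which
    d does not kill, it contains a slice v ([slice_in_subfield]); hence it
    contains every function, a polynomial in v over the kernel of d. *)
Lemma field_Derksen_full (h : F) : (exists f, d f != 0) ->
  field_Derksen X h -> ~ field_kernel d h -> field_Derksen X = setT.
Proof.
move=> dn Kh dh; have dl := generator_lnd s_act; have [dd dnil] := dl.
have [dD _ _] := dd.
have [D [DD DM DE DC]] := extend_derivation dd.
have [tau tauE] := rmorphism_frac (can_inj sigmaK).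
have [u [du ddu]] := local_slice dl dn.
pose v := ratf u / ratf (d u).
have Dv : D v = 1 by apply: (slice_derivation DM DE).
have char0 := function_field_char0 X.
have Ksub := subfield_over_C_is_subfield field_Derksen_subfield.
have constK x : D x = 0 -> field_Derksen X x.
  by move=> Dx; apply: (kernel_sub_Derksen dl dn); exists D.
have tauK := field_Derksen_stable tauE.
have sigma_u : sigma u = u + d u by apply: pullback_slice.
have sigma_du : sigma (d u) = d u.
  have dddu : d (d (d u)) = 0.
    by rewrite ddu; apply: (addrI (d 0)); rewrite -dD !addr0.
  by rewrite [LHS](pullback_slice s_act dddu) ddu addr0.
have tau_v : tau v = v + 1.
  rewrite /v rmorphM fmorphV /= [tau _]tauE [tau (ratf (d u))]tauE sigma_u sigma_du.
  by rewrite tofracD mulrDl divff // tofrac_eq0.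
have tau_fixed x : tau x = x -> D x = 0.
  have [a [b [b0 ->]]] := fracP x.
  rewrite rmorphM fmorphV /= !tauE => /frac_eqP E.
  have sb0 : sigma b != 0 by rewrite sigma_neq0.
  apply/(derivation_fracE _ DM DE b0); apply: (pullback_fixed s_act b0).
  exact: (E sb0 b0).
have nilD a : exists k, iter k D (ratf a) = 0.
  by have [k ka] := dnil a; exists k; rewrite (iter_ratf _ _ DE) ka ratf0.
have Kv : field_Derksen X v.
  have [a [b [b0 hE]]] := fracP h.
  have [k ka] := nilD a; have [l lb] := nilD b.
  apply: (slice_in_subfield char0 DD DM Ksub constK Dv tauK tau_v tau_fixed ka lb).
  - by rewrite ratf_neq0.
  - by rewrite -[_ / _]hE.
  - apply/eqP => /(derivation_fracE _ DM DE b0) E; apply: dh; rewrite hE.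
    exact/(field_kernel_fracP _ dd b0).
apply/seteqP; split=> // x _; have [a [b [b0 ->]]] := fracP x.
have Kratf c : field_Derksen X (ratf c).
  have [k kc] := nilD c.
  exact: (nilpotent_in_subfield char0 DD DM Ksub constK Dv Kv kc).
exact: (subfieldM Ksub (Kratf a) (subfieldV Ksub (Kratf b))).
Qed.

End TwoActions.

Lemma independent_generators_Derksen (s1 s2 : 'I_n -> {poly P}) f g :
  additive_action s1 -> additive_action s2 ->
  generator s1 f * generator s2 g != generator s1 g * generator s2 f ->
  field_Derksen X = setT.
Proof.
move=> act1 act2 indep.
have l1 := generator_lnd act1; have l2 := generator_lnd act2.
have n1 : exists a, generator s1 a != 0.
  have [E1|] := eqVneq (generator s1 f) 0; last by exists f.
  by exists g; apply: contraNneq indep => E2; rewrite E1 E2 !mul0r.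
have n2 : exists a, generator s2 a != 0.
  have [E1|] := eqVneq (generator s2 f) 0; last by exists f.
  by exists g; apply: contraNneq indep => E2; rewrite E1 E2 !mulr0.
have : ~ (field_kernel (generator s2) `<=` field_kernel (@generator R X s1)).
  move=> sub; move/eqP: indep; apply.
  exact: (kernel_incl_proportional l1.1 l2 n2 sub).
move=> /existsNP[h /not_implyP[h2 h1]].
exact: (field_Derksen_full act1 n1 (kernel_sub_Derksen l2 n2 h2) h1).
Qed.

End Derksen.

(** * A tangent space spanned by one orbit *)

(** The argument is carried out for an abstract algebra A of functions on a set T,
    generated by [coord], and for a curve gamma in T along which A restricts to
    polynomials through phi. The hypothesis [kernel_square] says that the
    functions vanishing on the curve lie in the square of the maximal ideal of
    its origin x. *)
Section OrbitLine.
Variables (k : numFieldType) (A : idomainType) (const : {rmorphism k -> A}).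
Variables (T : Type) (value : T -> {rmorphism A -> k}).
Hypothesis value_const : forall y, cancel const (value y).
Hypothesis value_inj : forall f g, (forall y, value y f = value y g) -> f = g.
Variables (n : nat) (coord : 'I_n -> A).
Hypothesis coord_gen : forall f, exists p : {mpoly k[n]},
  forall y, value y f = p.@[fun i => value y (coord i)].

Variables (phi : {rmorphism A -> {poly k}}) (gamma : k -> T).
Hypothesis phi_gamma : forall f t, (phi f).[t] = value (gamma t) f.
Local Notation x := (gamma 0).
Variable d : A -> A.
Hypothesis phi_d : forall f, phi (d f) = (phi f)^`().

Lemma phi_const a : phi (const a) = a%:P.
Proof. by apply: poly_eq_eval => t; rewrite phi_gamma value_const hornerC. Qed.

(** The image of phi is stable under d/dt. Differentiating phi g down to degree
    one leaves a t + b with a != 0, and t is obtained by subtracting b and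
    dividing by a. *)
Lemma phi_surjective g : (phi g)`_1 != 0 -> exists q, phi q = 'X.
Proof.
set p := phi g => p1.
have size_p : (1 < size p)%N.
  by rewrite ltnNge; apply: contraNN p1 => /leq_sizeP ->.
have [e sE] : exists e, size p = e.+2.
  by exists (size p).-2; case: (size p) size_p => [|[]].
pose f := iter e d g.
have fE : phi f = p^`(e).
  by rewrite /f; elim: (e) => [|j IH] //; rewrite iterS phi_d IH derivnS.
pose a := p^`(e)`_1; pose b := p^`(e)`_0.
have a0 : a != 0.
  rewrite /a coef_derivn addn1 mulrn_eq0 negb_or -lt0n ffact_gt0 leqnSn /=.
  have -> : e.+1 = (size p).-1 by rewrite sE.
  rewrite -lead_coefE lead_coef_eq0.
  by rewrite -size_poly_gt0 sE.
exists (const a^-1 * (f - const b)).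
rewrite rmorphM rmorphB !phi_const fE.
apply/polyP => j; rewrite coefCM coefB coefC coefX.
case: j => [|[|j]] /=.
- by rewrite subrr mulr0.
- by rewrite subr0 mulVf.
- rewrite coef_derivn nth_default ?mul0rn ?subr0 ?mulr0 //.
  by rewrite sE addnS addnS !ltnS leq_addr.
Qed.

Hypothesis kernel_square : forall f, phi f = 0 -> exists2 a : 'I_n -> A,
  forall j, value x (a j) = 0 &
  forall y, value y f =
    \sum_j value y (a j) * (value y (coord j) - value x (coord j)).
Variable q : A.
Hypothesis phi_q : phi q = 'X.

(* The function p(q). The functions g i vanish on the curve; they generate the
   kernel of phi by kernel_generated. *)
Local Notation subst p := (map_poly const p).[q].
Local Notation g := (fun i => coord i - subst (phi (coord i))).

Lemma value_subst y p : value y (subst p) = p.[value y q].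
Proof. exact: retraction_horner. Qed.

Lemma phi_subst p : phi (subst p) = p.
Proof.
apply: poly_eq_eval => t.
by rewrite phi_gamma value_subst -phi_gamma phi_q hornerX.
Qed.

Lemma phi_g i : phi (g i) = 0.
Proof. by rewrite rmorphB phi_subst subrr. Qed.

Lemma value_q : value x q = 0.
Proof. by rewrite -phi_gamma phi_q hornerX. Qed.

(** Write f as a polynomial P in the coordinates. Modulo the functions g, it is
    equal to P evaluated at the phi (coord j) (q), that is (phi f)(q) = 0. *)
Lemma kernel_generated f : phi f = 0 -> exists b, f = \sum_j b j * g j.
Proof.
move=> f0; have [p pE] := coord_gen f.
pose h j := subst (phi (coord j)).
have [b E] := mmap_sub const coord h p; exists b; rewrite -E.
have -> : mmap const coord p = f.
  by apply: value_inj => y; rewrite (retraction_mmap _ _ (value_const y)) pE.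
have -> : mmap const h p = 0; last by rewrite subr0.
apply: value_inj => y; rewrite (retraction_mmap _ _ (value_const y)) rmorph0.
transitivity (phi f).[value y q]; last by rewrite f0 horner0.
rewrite phi_gamma pE; apply: meval_eq => i.
by rewrite value_subst phi_gamma.
Qed.

(** The product of the maximal ideal of x with the kernel of phi. *)
Definition mker f := exists2 e : 'I_n -> A,
  forall j, value x (e j) = 0 & f = \sum_j e j * g j.

Lemma mker_mul a f : value x a = 0 -> phi f = 0 -> mker (a * f).
Proof.
move=> a0 /kernel_generated[b ->]; exists (fun j => a * b j) => [j|].
  by rewrite rmorphM a0 mul0r.
by rewrite mulr_sumr; apply: eq_bigr => j _; rewrite mulrA.
Qed.

Lemma mker_add f h : mker f -> mker h -> mker (f + h).
Proof.
move=> [e e0 ->] [e' e'0 ->]; exists (fun j => e j + e' j) => [j|].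
  by rewrite rmorphD e0 e'0 addr0.
by rewrite -big_split; apply: eq_bigr => j _; rewrite /= mulrDl.
Qed.

Lemma kernel_of_mker f : mker f -> phi f = 0.
Proof.
move=> [e _ ->]; rewrite rmorph_sum big1 // => j _.
by rewrite rmorphM phi_g mulr0.
Qed.

(** phi a is divisible by t = phi q. *)
Lemma maximal_decomposition a : value x a = 0 ->
  exists u w, phi u = 0 /\ a = u + q * w.
Proof.
rewrite -phi_gamma => a0.
have /factor_theorem[r rE] : root (phi a) 0 by apply/rootP.
exists (a - q * subst r), (subst r); rewrite subrK; split=> //.
by rewrite rmorphB rmorphM phi_subst phi_q rE subr0 mulrC subrr.
Qed.

(** Write m for the maximal ideal of x and I for the kernel of phi. As m is
    I + q A, its square is contained in m I + q^2 A. If f is in I and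
    f = r + q^2 H with r in m I, applying phi gives t^2 phi H = 0, so H is in I
    and q^2 H is in m I as well. *)
Lemma mker_of_kernel f : phi f = 0 -> mker f.
Proof.
move=> f0; have [a a0 fE] := kernel_square f0.
pose c j := coord j - const (value x (coord j)).
have {}fE : f = \sum_j a j * c j.
  apply: value_inj => y; rewrite fE rmorph_sum; apply: eq_bigr => j _.
  by rewrite rmorphM rmorphB value_const.
have /choice[u /choice[w uw]] j := maximal_decomposition (a0 j).
have c0 j : value x (c j) = 0 by rewrite rmorphB value_const subrr.
have /choice[u' /choice[w' uw']] j := maximal_decomposition (c0 j).
pose H := \sum_j w j * w' j.
have E : f = \sum_j (c j * u j + (q * w j) * u' j) + q ^+ 2 * H.
  rewrite fE mulr_sumr -big_split; apply: eq_bigr => j _ /=.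
  rewrite [X in X * _](uw j).2 mulrDl [u j * _]mulrC -addrA; congr (_ + _).
  by rewrite {1}[c j](uw' j).2; ring.
have sE : mker (\sum_j (c j * u j + (q * w j) * u' j)).
  apply: (big_ind mker) => [||j _].
  - exists (fun=> 0) => [j|]; first by rewrite rmorph0.
    by rewrite big1 // => j _; rewrite mul0r.
  - exact: mker_add.
  - apply: mker_add; apply: mker_mul => //; first exact: (uw j).1.
      by rewrite rmorphM value_q mul0r.
    exact: (uw' j).1.
have H0 : phi H = 0.
  have := congr1 phi E; rewrite f0 rmorphD (kernel_of_mker sE) add0r rmorphM.
  rewrite rmorphXn phi_q => /esym/eqP.
  by rewrite mulf_eq0 expf_eq0 /= polyX_eq0 => /eqP.
rewrite E; apply: mker_add => //; apply: mker_mul => //.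
by rewrite rmorphXn value_q expr0n.
Qed.

Lemma coord_on_line y i : value y (coord i) = (phi (coord i)).[value y q].
Proof.
rewrite -value_subst; congr (value y _); apply/eqP; rewrite -subr_eq0; apply/eqP.
exact: (@nakayama_domain _ _ (value x) n g (fun i => mker_of_kernel (phi_g i)) i).
Qed.

End OrbitLine.

Section FlexiblePoint.
Variables (R : realType) (X : affine_variety R).
Local Notation C := R[i].
Local Notation n := (ambient_dim X).
Local Notation A := (coordinate_ring X).
Local Notation F := (function_field X).
Local Notation P := {mpoly C[n]}.
Local Notation const := (@coordinate_const R X).

Definition coord (i : 'I_n) : A := restr 'X_i.

Lemma value_coord y i : value y (coord i) = sval y 0 i.
Proof. by rewrite value_restr mevalXU. Qed.

Variable x : point_of X.
Local Notation c := (sval x).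

(** The tangent space is the annihilator of the gradients at c of the vanishing
    ideal, so the gradient of p is that of some g in the vanishing ideal
    ([double_annihilator]). Then p - g agrees with p on X and has no terms of
    order zero or one at c. *)
Lemma square_of_maximal_ideal (p : P) : p.@[c 0] = 0 ->
  (forall v, tangent_space c v -> \sum_i (p^`M(i)).@[c 0] * v 0 i = 0) ->
  exists2 a : 'I_n -> P, forall j, (a j).@[c 0] = 0 &
    forall y, points X y -> p.@[y 0] = \sum_j (a j).@[y 0] * (y 0 j - c 0 j).
Proof.
move=> p0 pT.
pose grad (q : P) : 'rV[C]_n := \row_i (q^`M(i)).@[c 0].
have gradE q i : grad q 0 i = (q^`M(i)).@[c 0] by rewrite mxE.
pose V := [set u : 'rV[C]_n | exists2 g, g \in @vanishing_ideal R X & u = grad g].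
have [g gI gE] : V (grad p).
  apply: double_annihilator.
  - exists 0; first exact: rpred0.
    by apply/rowP => i; rewrite !mxE mderiv0 meval0.
  - move=> a _ _ [g gI ->] [h hI ->]; exists (a%:MP * g + h).
      apply/vanishing_idealP => y Xy; rewrite mevalD mevalM.
      move/vanishing_idealP: gI => ->//; move/vanishing_idealP: hI => ->//.
      by rewrite mulr0 addr0.
    apply/rowP => i; rewrite gradE mderivD mderiv_mulC mevalD mevalM mevalC.
    by rewrite [LHS]mxE [X in X + _]mxE !gradE.
  - move=> w wV; under eq_bigr do rewrite mxE.
    apply: pT => g gI; rewrite -[RHS](wV (grad g)); last by exists g.
    by apply: eq_bigr => i _; rewrite mxE.
have [a] := mpoly_taylor1 (c 0) (p - g).
have g0 : g.@[c 0] = 0 by move/vanishing_idealP: gI; apply; apply: svalP.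
rewrite mevalB p0 g0 subr0 mpolyC0 add0r => E aE.
exists a => [j|y Xy].
  rewrite aE mderivB mevalB; move/rowP/(_ j): gE.
  by rewrite !gradE => ->; rewrite subrr.
have -> : p.@[y 0] = (p - g).@[y 0].
  by rewrite mevalB; move/vanishing_idealP: gI => ->; rewrite ?subr0.
rewrite [in LHS]E (raddf_sum (meval _)); apply: eq_bigr => j _ /=.
by rewrite mevalM mevalB mevalXU mevalC.
Qed.

(** Each coord j - c_j lies in the square of the maximal ideal that these
    functions generate, so it is zero by Nakayama: X is the point x and the
    functions on X are constant. *)
Lemma trivial_tangent_space_Derksen :
  tangent_space c `<=` [set 0] -> field_Derksen X = setT.
Proof.
move=> T0.
have coordE j : coord j - const (c 0 j) = 0.
  pose g i := coord i - const (c 0 i); rewrite -[LHS]/(g j).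
  apply: (@nakayama_domain _ _ (value x)) => i.
  have [||a a0 aE] := @square_of_maximal_ideal ('X_i - (c 0 i)%:MP).
  - by rewrite mevalB mevalXU mevalC subrr.
  - by move=> v /T0 ->; rewrite big1 // => l _; rewrite mxE mulr0.
  exists (fun l => restr (a l)) => [l|]; first by rewrite /= value_restr.
  apply: value_inj => y; rewrite (raddf_sum (value y)) /g /=.
  rewrite valueB value_coord value_const.
  have := aE _ (svalP y); rewrite mevalB mevalXU mevalC => ->.
  apply: eq_bigr => l _ /=.
  by rewrite valueM valueB value_restr value_coord value_const.
have point_x y : y = x.
  apply: point_inj; apply/rowP => j; rewrite -value_coord.
  by have /subr0_eq -> := coordE j; rewrite value_const.
have constE f : f = const (value x f).
  by apply: value_inj => y; rewrite (point_x y) value_const.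
apply/seteqP; split=> // h _; have [a [b [b0 ->]]] := fracP h.
have [KC _ KM KV] := field_Derksen_subfield X.
rewrite (constE a) (constE b).
exact: (KM _ _ (KC _) (KV _ (KC _))).
Qed.

Section Action.
Variable s : 'I_n -> {poly P}.
Hypothesis s_act : additive_action s.

Lemma along_restr p : along s x (restr p) = mmap polyC (orbit_poly s c) p.
Proof.
apply: poly_eq_eval => t; rewrite alongE value_restr horner_mmap.
by apply: meval_eq => i; rewrite mxE.
Qed.

Lemma along_coord i : along s x (coord i) = orbit_poly s c i.
Proof. by rewrite along_restr mmapX mmap1U. Qed.

Lemma value_generator_coord i :
  value x (generator s (coord i)) = orbit_tangent s c 0 i.
Proof. by rewrite value_generator // along_coord mxE. Qed.

(** A function vanishing on the orbit has a differential that kills the tangent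
    vector of the orbit, hence the tangent space, so it lies in the square of
    the maximal ideal of x and [coord_on_line] applies. The isomorphism is the
    orbit map, with inverse q. *)
Lemma orbit_isomorphic_to_line i : orbit_tangent s c 0 i != 0 ->
  (forall v, tangent_space c v -> exists a, v = a *: orbit_tangent s c) ->
  isomorphic_to_line X.
Proof.
move=> vi0 Tv.
pose phi := along_rmorphism s_act x.
pose gamma t := flow s_act t x.
have phi_gamma f t : (phi f).[t] = value (gamma t) f by exact: alongE.
have gamma0 : gamma 0 = x by exact: flow0.
have phi_d f : phi (generator s f) = (phi f)^`() by exact: along_generator.
have constK (y : point_of X) : cancel const (value y) by move=> a; exact: value_const.
have [q phi_q] : exists q, phi q = 'X.
  apply: (@phi_surjective C A const _ (@value R X) constK phi gamma phi_gamma
    (generator s) phi_d (coord i)).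
  have -> : phi (coord i) = orbit_poly s c i by exact: along_coord.
  by move: vi0; rewrite mxE horner_coef0 coef_deriv mulr1n.
have kernel_square f : phi f = 0 -> exists2 a : 'I_n -> A,
    forall j, value (gamma 0) (a j) = 0 &
    forall y, value y f =
      \sum_j value y (a j) * (value y (coord j) - value (gamma 0) (coord j)).
  have [p <-] := restr_surj f => p0; rewrite gamma0.
  have {}p0 : mmap polyC (orbit_poly s c) p = 0 by rewrite -along_restr.
  have orbit0 : c = act s 0 c by case: s_act => _ E _; rewrite E //; exact: svalP.
  have eval0 (r : P) : (mmap polyC (orbit_poly s c) r).[0] = r.@[c 0].
    rewrite horner_mmap; apply: meval_eq => j.
    by rewrite [in RHS]orbit0 mxE.
  have [||a a0 aE] := @square_of_maximal_ideal p.
  - by rewrite -eval0 p0 horner0.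
  - move=> v /Tv[a ->].
    transitivity (a * (mmap polyC (orbit_poly s c) p)^`().[0]); last first.
      by rewrite p0 deriv0 horner0 mulr0.
    rewrite deriv_mmap horner_sum mulr_sumr; apply: eq_bigr => j _.
    by rewrite hornerM eval0 !mxE mulrCA.
  exists (fun j => restr (a j)) => [j|y]; first by rewrite /= value_restr.
  rewrite /= value_restr aE; last exact: svalP.
  by apply: eq_bigr => j _; rewrite value_restr !value_coord.
have coord_gen f : exists p : P,
    forall y, value y f = p.@[fun i => value y (coord i)].
  have [p <-] := restr_surj f; exists p => y; rewrite value_restr.
  by apply: meval_eq => l; rewrite value_coord.
have coordE (y : point_of X) j : sval y 0 j = (orbit_poly s c j).[value y q].
  rewrite -value_coord -along_coord.
  exact: (@coord_on_line C A const _ (@value R X) constK (@value_inj R X) _ coord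
    coord_gen phi gamma phi_gamma kernel_square q phi_q y j).
have [g gq] := restr_surj q.
exists g, (orbit_poly s c); split=> [t|t|y Xy].
- by case: s_act => sX _ _; apply/sX/svalP.
- have := phi_gamma q t; rewrite phi_q hornerX -gq value_restr => tE.
  by rewrite [RHS]tE; apply: meval_eq => j; rewrite mxE.
- apply/rowP => j; rewrite mxE.
  have := coordE (exist _ y Xy) j.
  by rewrite -gq value_restr => <-.
Qed.

End Action.
End FlexiblePoint.

(** * The field Derksen invariant of a flexible variety *)

(* The affine line is the only variety over the complex numbers with a
   flexible point for which the equality fails: its field Derksen invariant
   is the field of constants. *)
Theorem theorem4 (R : realType) (X : affine_variety R)
  (X_not_line : ~ isomorphic_to_line X)
  (X_flexible : exists x, flexible_point X x) :
  field_Derksen X = setT.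
Proof.
have [c [Xc TE]] := X_flexible; pose x : point_of X := exist _ c Xc.
have [[s1 [s2 [i [j [act1 act2 indep]]]]]|dep] :=
    pselect (exists s1 s2 i j, [/\ additive_action s1, additive_action s2 &
      orbit_tangent s1 c 0 i * orbit_tangent s2 c 0 j !=
      orbit_tangent s1 c 0 j * orbit_tangent s2 c 0 i]).
  apply: (independent_generators_Derksen (f := coord i) (g := coord j) act1 act2).
  apply: contraNneq indep => /(congr1 (value x)).
  by rewrite !valueM !value_generator_coord //= => ->.
have tangent_sub (V : set 'rV_(ambient_dim X)) : linear_subspace V ->
    (forall s, additive_action s -> V (orbit_tangent s c)) ->
    tangent_space c `<=` V.
  move=> Vsub Vs; rewrite -TE.
  by apply: smallest_sub => // v [s sact ->]; apply: Vs.
have [[s [i [act vi0]]]|triv] :=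
    pselect (exists s i, additive_action s /\ orbit_tangent s c 0 i != 0).
  case: X_not_line; apply: (orbit_isomorphic_to_line (x := x) act vi0).
  apply: tangent_sub => [|s' act'].
    split=> [|a _ _ [b ->] [b' ->]]; first by exists 0; rewrite scale0r.
    by exists (a * b + b'); rewrite scalerDl scalerA.
  (* All minors of s and s' vanish, so the tangent of s' is this multiple of
     that of s. *)
  exists (orbit_tangent s' c 0 i / orbit_tangent s c 0 i).
  apply/rowP => j; rewrite [RHS]mxE mulrAC; apply: (canRL (mulfK vi0)).
  apply: contrapT => E; apply: dep; exists s', s, j, i; split=> //.
  by apply/eqP.
apply: (@trivial_tangent_space_Derksen _ _ x); apply: tangent_sub.
  split=> // a u v -> ->.
  by rewrite scaler0 addr0.
move=> s act; apply/rowP => i; rewrite [RHS]mxE; apply: contrapT => /eqP v0.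
by apply: triv; exists s, i.
Qed.
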